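(* In the setting described in the context, for every $i\in[N]$ and every $\ell$ with $1\le\ell\le N-1$: if $y_i=y^{(\mathrm{val})}$, $$G_{i,\ell}=\begin{cases}\sum_{m\in[N]\setminus\{i\}}\sum_{s\in[-\widetilde w_i,0)}F_i[m,\ell,s] & \ell\le K-1,\\ \sum_{m\in[N]\setminus\{i\}}\sum_{s\in[-\widetilde w_i,-\widetilde w_m)}F_i[m,\ell,s] & \ell\ge K,\end{cases}$$ and if $y_i\ne y^{(\mathrm{val})}$, $$G_{i,\ell}=\begin{cases}\sum_{m\in[N]\setminus\{i\}}\sum_{s\in[0,-\widetilde w_i)}F_i[m,\ell,s] & \ell\le K-1,\\ \sum_{m\in[N]\setminus\{i\}}\sum_{s\in[-\widetilde w_m,-\widetilde w_i)}F_i[m,\ell,s] & \ell\ge K.\end{cases}$$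
   Context: Training set $D=\{z_1,\dots,z_N\}$, $z_i=(x_i,y_i)$, validation point $z^{(\mathrm{val})}=(x^{(\mathrm{val})},y^{(\mathrm{val})})$, points indexed so that $d(x_1,x^{(\mathrm{val})})\le\cdots\le d(x_N,x^{(\mathrm{val})})$. For $S\subseteq D$ and $1\le j\le|S|$, $\alpha(S,j)$ is the $j$-th smallest index of a point of $S$. Integer $K\ge1$; weights $w_j\in[0,1]$; signed weights $\widetilde w_j=w_j$ if $y_j=y^{(\mathrm{val})}$, $-w_j$ otherwise. Conditions for $S\subseteq D\setminus\{z_i\}$: $\mathrm{Cond}_{KNN}$: $|\{z_j\in S:j<i\}|\le K-1$. $\mathrm{Cond}_{0\to1}$: if $|S|\le K-1$, $\sum_{z_j\in S}\widetilde w_j\in[-\widetilde w_i,0)$; if $|S|\ge K$, $\sum_{j=1}^{K-1}\widetilde w_{\alpha(S,j)}\in[-w_i,-\widetilde w_{\alpha(S,K)})$. $\mathrm{Cond}_{1\to0}$: if $|S|\le K-1$, $\sum_{z_j\in S}\widetilde w_j\in[0,-\widetilde w_i)$; if $|S|\ge K$, $\sum_{j=1}^{K-1}\widetilde w_{\alpha(S,j)}\in[-\widetilde w_{\alpha(S,K)},-\widetilde w_i)$. $G_{i,\ell}$: number of $S\subseteq D\setminus\{z_i\}$, $|S|=\ell$, satisfying $\mathrm{Cond}_{KNN}$ and $\mathrm{Cond}_{0\to1}$ (if $y_i=y^{(\mathrm{val})}$) or $\mathrm{Cond}_{1\to0}$ (if $y_i\ne y^{(\mathrm{val})}$). $F_i[m,\ell,s]$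 (for $m\in[N]$, $1\le\ell\le N-1$, $s\in\mathbb{R}$): number of $S\subseteq D\setminus\{z_i\}$ with $|S|=\ell$ satisfying $\mathrm{Cond}_{KNN}$, $\alpha(S,\min(\ell,K))=m$ (i.e. $x_m$ is the $\min(\ell,K)$-th closest point of $S$ to $x^{(\mathrm{val})}$), and $\sum_{j=1}^{\min(\ell,K-1)}\widetilde w_{\alpha(S,j)}=s$. A sum $\sum_{s\in[a,b)}F_i[m,\ell,s]$ ranges over the finitely many real $s\in[a,b)$ with $F_i[m,\ell,s]\ne0$. *)

(* Defs.v *)
From HB Require Import structures.
From mathcomp Require Import all_boot all_order all_algebra.
From mathcomp Require Import reals.

Set Implicit Arguments.
Unset Strict Implicit.
Unset Printing Implicit Defensive.

Import Order.TTheory GRing.Theory Num.Theory.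
Local Open Scope ring_scope.

(* The training points are represented by their indices, so a subset of the   *)
(* training set is a set of indices in 'I_N (numbered from 0 instead of 1).   *)
Section WeightedKNN.

Variables (R : realType) (N : nat) (Y : eqType).
Variables (y : 'I_N -> Y) (yval : Y) (w : 'I_N -> R) (K : nat).

Definition signed_weight (j : 'I_N) : R :=
  if y j == yval then w j else - w j.

(* enum S lists S in increasing order; j is counted from 1, and i0 is a       *)
(* default value that is returned only when j > #|S|.                         *)
Definition alpha (i0 : 'I_N) (S : {set 'I_N}) (j : nat) : 'I_N :=
  nth i0 (enum S) j.-1.

Definition cond_knn (i : 'I_N) (S : {set 'I_N}) : bool :=
  (#|[set j in S | (j < i)%N]| <= K - 1)%N.

Definition cond01 (i : 'I_N) (S : {set 'I_N}) : bool :=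
  if (#|S| <= K - 1)%N
  then \sum_(j in S) signed_weight j \in `[- signed_weight i, 0[
  else \sum_(1 <= j < K) signed_weight (alpha i S j)
         \in `[- w i, - signed_weight (alpha i S K)[.

Definition cond10 (i : 'I_N) (S : {set 'I_N}) : bool :=
  if (#|S| <= K - 1)%N
  then \sum_(j in S) signed_weight j \in `[0, - signed_weight i[
  else \sum_(1 <= j < K) signed_weight (alpha i S j)
         \in `[- signed_weight (alpha i S K), - signed_weight i[.

Definition Gcount (i : 'I_N) (l : nat) : nat :=
  #|[set S : {set 'I_N} |
      [&& i \notin S, #|S| == l, cond_knn i S
        & if y i == yval then cond01 i S else cond10 i S]]|.

Definition Fcount (i m : 'I_N) (l : nat) (s : R) : nat :=
  #|[set S : {set 'I_N} |
      [&& i \notin S, #|S| == l, cond_knn i S, alpha i S (minn l K) == m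
        & \sum_(1 <= j < (minn l (K - 1)).+1)
            signed_weight (alpha i S j) == s]]|.

End WeightedKNN.

(* Main.v *)
(* Both sides count the same index sets S: the right-hand side groups them by
   the index m of the (minn l K)-th closest point of S and by the value s of the
   partial signed sum, the only data of S that cond01 and cond10 depend on once
   #|S| = l. The index m is never i because it belongs to S. *)

Require Import Defs.
From HB Require Import structures.
From mathcomp Require Import all_boot all_order all_algebra.
From mathcomp Require Import classical_sets fsbigop set_interval reals.
From mathcomp Require Import zify.

Import Order.TTheory GRing.Theory Num.Theory.
Local Open Scope ring_scope.

(** Double counting: each [t] with [P t] and [f t \in A] lies in exactly one fibre, that of
    [s = f t]. The set [A] may be infinite, as a real interval is, but only the finitely many values
    of [f] have nonempty fibres. *)
Lemma fsbig_card_fiber (T : finType) (U : choiceType) (P : pred T) (f : T -> U)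
    (A : {pred U}) :
  \big[addn/0%N]_(s \in [set` A]%classic) #|[set t | P t && (f t == s)]| =
  #|[set t | P t && (f t \in A)]|.
Proof.
rewrite -(bigfs _ (undup_uniq (codom f))) => [|s _]; last first.
  rewrite mem_undup => sNf; apply/eqP; rewrite cards_eq0; apply/eqP/setP => t.
  by rewrite !inE; apply/andP => -[_ /eqP fts]; rewrite -fts codom_f in sNf.
rewrite -sum1dep_card.
under eq_bigr do rewrite -sum1dep_card.
rewrite (exchange_big_dep (fun t => P t && (f t \in A))) /=; last first.
  by move=> s t As /andP[-> /eqP ->].
apply: eq_bigr => t /andP[Pt Aft].
(* For fixed [t] only [s = f t] contributes, and it is listed once since [undup] removed
   repetitions. *)
rewrite (eq_bigl (pred1 (f t))) => [|s]; last first.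
  by rewrite Pt /= eq_sym andbC; case: eqP => // ->; rewrite [_ (f t)]Aft.
by rewrite sum1_count count_uniq_mem ?undup_uniq ?mem_undup ?codom_f.
Qed.

Section GcountFcount.
Variables (R : realType) (N : nat) (Y : eqType).
Variables (y : 'I_N -> Y) (yval : Y) (w : 'I_N -> R) (K : nat).

Lemma alpha_in (i : 'I_N) (S : {set 'I_N}) (j : nat) :
  (0 < j <= #|S|)%N -> alpha i S j \in S.
Proof. by case: j => // j jS; rewrite -mem_enum mem_nth // -cardE. Qed.

Lemma sum_alpha (i : 'I_N) (S : {set 'I_N}) (g : 'I_N -> R) :
  \sum_(1 <= j < #|S|.+1) g (alpha i S j) = \sum_(j in S) g j.
Proof. by rewrite -big_enum (big_nth i) -cardE big_add1. Qed.

(** Treats the four cases of the theorem at once: [J m] is the interval allowed for the partial sum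
    when [m] is the point of rank [minn l K]. *)
Lemma Gcount_Fcount (i : 'I_N) (l : nat) (J : 'I_N -> interval R) :
    (0 < l)%N -> (0 < K)%N ->
    (forall S : {set 'I_N}, #|S| = l ->
      (if y i == yval then cond01 y yval w K i S else cond10 y yval w K i S) =
      (\sum_(1 <= j < (minn l (K - 1)).+1)
         signed_weight y yval w (alpha i S j) \in J (alpha i S (minn l K)))) ->
  Gcount y yval w K i l =
  (\sum_(m < N | m != i)
     \big[addn/0]_(s \in [set` J m]%classic) Fcount y yval w K i m l s)%N.
Proof.
move=> l0 K0 condE.
pose f (S : {set 'I_N}) := \sum_(1 <= j < (minn l (K - 1)).+1)
  signed_weight y yval w (alpha i S j).
pose a (S : {set 'I_N}) := alpha i S (minn l K).
pose P (S : {set 'I_N}) := [&& i \notin S, #|S| == l & cond_knn K i S].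
have FE m s : Fcount y yval w K i m l s =
    #|[set S | (P S && (a S == m)) && (f S == s)]|.
  by apply: eq_card => S; rewrite !inE /P -!andbA.
under eq_bigr => m _.
  under eq_fsbigr => s _ do rewrite FE.
  rewrite fsbig_card_fiber -sum1dep_card; over.
rewrite /Gcount -sum1dep_card (partition_big a (fun m => m != i)) /=; last first.
  (* The rank [minn l K] lies between 1 and [#|S|], so [alpha] returns a point of [S] and not its
     default [i], which is outside [S]. *)
  move=> S /and4P[iNS /eqP Sl _ _]; apply: contraNneq iNS => <-.
  by apply: alpha_in; rewrite leq_min l0 K0 Sl geq_minl.
apply: eq_bigr => m _; apply: eq_bigl => S; rewrite /P -!andbA.
case: (boolP (i \in S)) => //= _; case: eqP => //= Sl; case: cond_knn => //=.
by rewrite condE // andbC; case: eqP => // <-.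
Qed.

End GcountFcount.

Theorem theorem3 (R : realType) (N : nat) (X : Type) (Y : eqType)
    (d : X -> X -> R) (x : 'I_N -> X) (y : 'I_N -> Y) (xval : X) (yval : Y)
    (w : 'I_N -> R) (K : nat)
    (hsort : forall j k : 'I_N, (j <= k)%N -> d (x j) xval <= d (x k) xval)
    (hK : (1 <= K)%N)
    (hw : forall j : 'I_N, 0 <= w j <= 1)
    (i : 'I_N) (l : nat) (hl : (1 <= l <= N - 1)%N) :
  let sw := signed_weight y yval w in
  let G := Gcount y yval w K in
  let F := Fcount y yval w K in
  (y i = yval ->
     ((l <= K - 1)%N ->
        G i l = (\sum_(m < N | m != i)
          \big[addn/0]_(s \in `[(- sw i)%R, 0%R[%classic) F i m l s)%N) /\
     ((K <= l)%N ->
        G i l = (\sum_(m < N | m != i)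
          \big[addn/0]_(s \in `[(- sw i)%R, (- sw m)%R[%classic) F i m l s)%N))
  /\
  (y i <> yval ->
     ((l <= K - 1)%N ->
        G i l = (\sum_(m < N | m != i)
          \big[addn/0]_(s \in `[0%R, (- sw i)%R[%classic) F i m l s)%N) /\
     ((K <= l)%N ->
        G i l = (\sum_(m < N | m != i)
          \big[addn/0]_(s \in `[(- sw m)%R, (- sw i)%R[%classic) F i m l s)%N)).
Proof.
move=> sw G F; case/andP: hl => l0 _.
have minl : (l <= K - 1)%N -> minn l (K - 1) = l by move/minn_idPl.
(* As [0 < K], the truncated [K - 1] has successor [K]: the sum in [Fcount] covers ranks 1 to
   [K - 1], and [m] is the point of rank [K]. *)
have minK : (K <= l)%N -> (minn l (K - 1)).+1 = K /\ minn l K = K.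
  by move=> Kl; split; lia.
have lK : (K <= l)%N -> (l <= K - 1)%N = false by lia.
split=> yi; (split=> [lK1|Kl]; [|have [mK1 mK] := minK Kl]).
(* Here the interval is the same for all [m], and the partial sum runs over the whole of [S], so
   [sum_alpha] identifies it with the sum in [cond01]. *)
- apply: (@Gcount_Fcount _ _ _ _ _ _ _ i l (fun=> `[- sw i, 0[)) => // S Sl.
  by rewrite yi eqxx /cond01 minl // Sl lK1 -Sl sum_alpha.
- apply: (@Gcount_Fcount _ _ _ _ _ _ _ i l (fun m => `[- sw i, - sw m[)) => //.
  move=> S Sl; rewrite yi eqxx /cond01 Sl lK // mK1 mK.
  (* cond01 bounds the sum by - w i, which is - sw i because y i = yval. *)
  by rewrite /sw /signed_weight yi eqxx.
- apply: (@Gcount_Fcount _ _ _ _ _ _ _ i l (fun=> `[0, - sw i[)) => // S Sl.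
  by move/eqP/negPf: yi => ->; rewrite /cond10 minl // Sl lK1 -Sl sum_alpha.
- apply: (@Gcount_Fcount _ _ _ _ _ _ _ i l (fun m => `[- sw m, - sw i[)) => //.
  by move=> S Sl; move/eqP/negPf: yi => ->; rewrite /cond10 Sl lK // mK1 mK.
Qed.
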